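(* Let $\mu$ be a Borel probability measure on $\mathbb{R}$ and let $\epsilon>0$. If the inverse measure $\mu^{-1}$ is absolutely continuous with respect to Lebesgue measure $\lambda$, then $$\lim_{n\to\infty} n\, d_{\epsilon}(\mu,\delta_{\bullet}^{u_n}) = \left\| \,\Omega\!\left(\epsilon\,\frac{\mathrm{d}\mu^{-1}}{\mathrm{d}\lambda}\right)\right\|_{\infty}.$$
   Context: $\mathbb{R}^+$ denotes the positive reals, and $\lambda$ is Lebesgue measure on $\mathbb{R}$. For a Borel probability measure $\mu$ on $\mathbb{R}$ let $F_\mu(x)=\mu((-\infty,x])$ and $F_{\mu-}(x)=\mu((-\infty,x))$. For $\epsilon>0$ the $\epsilon$-Lévy metric is $$d_\epsilon(\mu,\nu)=\inf\{y\in\mathbb{R}^+ : F_{\mu-}(x-y/\epsilon)-y\le F_\nu(x)\le F_\mu(x+y/\epsilon)+y \text{ for all } x\in\mathbb{R}\}.$$ Best uniform approximation: for $n\in\mathbb{N}=\{1,2,\ldots\}$ let $\Xi_n=\{x\in\mathbb{R}^n: x_{,1}\le\ldots\le x_{,n}\}$ and, for $x\in\Xi_n$, $\delta_x^{u_n}=\frac1n\sum_{j=1}^n\delta_{x_{,j}}$, where $\delta_a$ is the unit point mass at $a$. The symbol $\delta_\bullet^{u_n}$ denotes any best uniform $d_\epsilon$-approximation of $\mu$, that is, any $\delta_x^{u_n}$ with $x\in\Xi_n$ such that $d_\epsilon(\mu,\delta_x^{u_n})\le d_\epsilon(\mu,\delta_y^{u_n})$ for all $y\in\Xi_n$ (such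 a minimizer exists); thus $d_\epsilon(\mu,\delta_\bullet^{u_n})=\min_{x\in\Xi_n}d_\epsilon(\mu,\delta_x^{u_n})$. Inverse measure: let $F_\mu^{-1}(t)=\sup\{y\in\mathbb{R}:F_\mu(y)\le t\}\in[-\infty,+\infty]$ for $t\in\mathbb{R}$ (with $\sup\varnothing=-\infty$); it is non-decreasing, right-continuous, and real-valued on $(0,1)$. The inverse measure $\mu^{-1}$ is the $\sigma$-finite positive Borel measure on $\mathbb{R}$ with $\mu^{-1}(\mathbb{R}\setminus(0,1))=0$ and $\mu^{-1}((x,y])=F_\mu^{-1}(y)-F_\mu^{-1}(x)$ for all $0<x\le y<1$. The function $\Omega:\mathbb{R}\to\mathbb{R}$ is $\Omega(x)=\dfrac{x}{2+2|x|}$. $\|\cdot\|_\infty$ is the essential supremum norm with respect to $\lambda$. *)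

(* Defs.v *)
From HB Require Import structures.
From mathcomp Require Import all_boot all_order all_algebra.
From mathcomp Require Import all_classical all_reals all_analysis.

Set Implicit Arguments.
Unset Strict Implicit.
Unset Printing Implicit Defensive.

Import Order.TTheory GRing.Theory Num.Theory.
Import numFieldNormedType.Exports.

Local Open Scope classical_set_scope.
Local Open Scope ring_scope.

(* Borel probability measures on the real line. *)
Notation borel_probability R := (probability (measurableTypeR R) R).

Section levy.
Context {R : realType}.
Implicit Types mu nu : borel_probability R.
Local Open Scope ereal_scope.

Definition distr_fun mu (x : R) : \bar R := mu `]-oo, x]%classic.

Definition distr_fun_left mu (x : R) : \bar R := mu `]-oo, x[%classic.

(* The infimum is over a nonempty set bounded below by 0: it contains 1. *)
Definition levy (eps : R) mu nu : R :=
  inf [set y : R | (0 < y)%R /\ forall x : R,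
    distr_fun_left mu (x - y / eps)%R - y%:E <= distr_fun nu x /\
    distr_fun nu x <= distr_fun mu (x + y / eps)%R + y%:E].

(* [ereal_sup set0 = -oo], as required of the supremum of the empty set. *)
Definition inv_distr_fun mu (t : R) : \bar R :=
  ereal_sup [set y%:E | y in [set y : R | distr_fun mu y <= t%:E]].

(* The conditions determine the measure [nu] uniquely; [inv_distr_fun mu] is
   finite on ]0, 1[, so that the subtraction is a genuine one. *)
Definition is_inverse_measure mu
    (nu : {sigma_finite_measure set (measurableTypeR R) -> \bar R}) : Prop :=
  nu (~` `]0%R, 1%R[%classic) = 0 /\
  forall x y : R, (0 < x)%R -> (x <= y)%R -> (y < 1)%R ->
    nu `]x, y]%classic = inv_distr_fun mu y - inv_distr_fun mu x.

(* The library's derivative ['d nu '/d la] requires [nu] to be finite, which an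
   inverse measure need not be; [f] is a (nonnegative, finite) version of the
   density of [nu] with respect to Lebesgue measure. *)
Definition is_lebesgue_density
    (nu : {sigma_finite_measure set (measurableTypeR R) -> \bar R})
    (f : measurableTypeR R -> R) : Prop :=
  [/\ measurable_fun setT f,
      (forall t, (0 <= f t)%R) &
      forall A : set (measurableTypeR R), measurable A ->
        nu A = \int[lebesgue_measure]_(t in A) (f t)%:E].

End levy.

Section uniform_approximation.
Context {R : realType}.
Local Open Scope ereal_scope.

(* Sizes are positive: a tuple [x] of size n.+1 gives n.+1 atoms (with
   multiplicity), each of mass 1 / n.+1. *)
Definition unif_dirac n (x : n.+1.-tuple R) :
    set (measurableTypeR R) -> \bar R :=
  mscale (n.+1%:R^-1 : R)%:nng%R
    (msum (fun j => \d_(nth 0%R x j : measurableTypeR R)) n.+1).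

HB.instance Definition _ n (x : n.+1.-tuple R) := Measure.on (unif_dirac x).

Lemma unif_diracT n (x : n.+1.-tuple R) : unif_dirac x setT = 1.
Proof.
rewrite /unif_dirac /mscale /= /msum.
rewrite (eq_bigr (fun=> 1)) => [|j _]; last by rewrite /= diracE in_setT.
by rewrite sumEFin sumr_const card_ord -EFinM mulVf.
Qed.

HB.instance Definition _ n (x : n.+1.-tuple R) :=
  Measure_isProbability.Build _ _ R (unif_dirac x) (unif_diracT x).

Lemma unif_diracE n (x : n.+1.-tuple R) (A : set (measurableTypeR R)) :
  unif_dirac x A =
  (n.+1%:R^-1)%R%:E * \sum_(j < n.+1) \d_(tnth x j : measurableTypeR R) A.
Proof.
rewrite /unif_dirac /mscale /= /msum; congr (_ * _).
by apply: eq_bigr => j _; rewrite (tnth_nth 0%R).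
Qed.

Definition is_best_unif_approx (eps : R) (mu : borel_probability R) n
    (x : n.+1.-tuple R) : Prop :=
  sorted <=%R x /\
  forall y : n.+1.-tuple R, sorted <=%R y ->
    (levy eps mu (unif_dirac x) <= levy eps mu (unif_dirac y))%R.

End uniform_approximation.

Definition Omega {R : realType} (x : R) : R := x / (2 + 2 * `|x|).

(* Main.v *)
From HB Require Import structures.
Require Import Defs.
From mathcomp Require Import all_boot all_order all_algebra.
From mathcomp Require Import all_classical all_reals all_analysis.
From mathcomp Require Import measurable_realfun ess_sup_inf ring lra.
Import Order.TTheory GRing.Theory Num.Theory.
Import numFieldNormedType.Exports.
Local Open Scope classical_set_scope.
Local Open Scope ring_scope.

(** Write [N = n.+1], let [G] be the upper quantile function of [mu] (whose
    increments are the integrals of the density [f]), and cut [0, 1] into the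
    [N] cells [j / N, (j + 1) / N].  Reading the two inequalities that define
    the Levy distance at the atoms [x_0 <= ... <= x_(N-1)], and inverting the
    distribution function, a radius [y = c / N] with [c < 1/2] is admissible
    exactly when, up to arbitrarily small changes of [c],
      [G ((j + 1 - c) / N) - y / eps <= x_j <= G ((j + c) / N) + y / eps]
    for every [j].  Such an [x_j] exists as soon as the increment of [G] over
    the core of the cell, from [(j + c) / N] to [(j + 1 - c) / N], is at most
    [2 c / (eps N)]: the average of [f] over that core, which has length
    [(1 - 2 c) / N], must be at most [K = 2 c / (eps (1 - 2 c))].  Finally
    [f t <= K] says the same as [Omega (eps * f t) <= c], and this is where
    [Omega] comes from.

    Upper bound ([levy_best_le_half], [levy_best_le_of_density]): if
    [Omega (eps * f) <= c] almost everywhere, all averages of [f] are at most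
    [K], and the quantiles of the cell midpoints form an admissible choice of
    atoms for every radius above [c / N] ([levy_mid_quantiles_le]).  The
    constant 1/2 is always allowed, the cores being then empty.  So [N] times
    the optimal distance is below the essential supremum for every [N].

    Lower bound ([near_levy_best_ge]): if [N] times the optimal distance is
    below [c] for infinitely many [N], then for those [N] the averages of [f]
    over all cores are at most [K] ([levy_quantile_gap]).  The cores of the
    cells containing a given point shrink nicely to it, so Lebesgue's
    differentiation theorem gives [f <= K] almost everywhere on ]0, 1[, hence
    [Omega (eps * f) <= c] almost everywhere; this fails when [c] is below the
    essential supremum.

    The essential supremum itself is at most 1/2, so the two bounds give a
    finite limit even when [f] is unbounded. *)

Set Implicit Arguments.
Unset Strict Implicit.

(** * Distribution functions and quantiles *)

Section quantile.
Context {R : realType} (mu : borel_probability R).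
Local Open Scope ereal_scope.

Lemma le_distr_fun (x y : R) : (x <= y)%R -> distr_fun mu x <= distr_fun mu y.
Proof. by move=> xy; rewrite le_measure ?inE//; exact: subitvPr. Qed.

Lemma distr_fun_le_left (x y : R) : (x < y)%R ->
  distr_fun mu x <= distr_fun_left mu y.
Proof. by move=> xy; rewrite le_measure ?inE//; exact: subitvPr. Qed.

Lemma distr_fun_left_le (x y : R) : (x <= y)%R ->
  distr_fun_left mu x <= distr_fun mu y.
Proof. by move=> xy; rewrite le_measure ?inE//; exact: subitvPr. Qed.

Lemma le_inv_distr_fun (z t : R) :
  distr_fun mu z <= t%:E -> z%:E <= inv_distr_fun mu t.
Proof. by move=> zt; apply: ereal_sup_ubound; exists z. Qed.

Lemma distr_fun_le_of_lt_inv (z t : R) :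
  z%:E < inv_distr_fun mu t -> distr_fun mu z <= t%:E.
Proof.
move=> /ereal_sup_gt[_ [z' /= z't <-]]; rewrite lte_fin => /ltW zz'.
exact: le_trans (le_distr_fun zz') z't.
Qed.

Lemma inv_distr_fun_ndecr (s t : R) :
  (s <= t)%R -> inv_distr_fun mu s <= inv_distr_fun mu t.
Proof.
move=> st; apply: le_ereal_sup => _ [z zs <-]; exists z => //=.
by apply: le_trans zs _; rewrite lee_fin.
Qed.

(* [mu] is the law of the identity, so the limits at infinity of its
   distribution function are those of the cdf of that random variable. *)
Let idR : measurableTypeR R -> R := idfun.

HB.instance Definition _ :=
  @isMeasurableFun.Build _ _ (measurableTypeR R) R idR (@measurable_id _ _ setT).

(** The distribution function takes values below and above [t], because it
    tends to 0 and 1 at the two infinities. *)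
Lemma inv_distr_fun_fin_num (t : R) : (0 < t < 1)%R ->
  inv_distr_fun mu t \is a fin_num.
Proof.
move=> /andP[t0 t1].
have [z zt] : exists z : R, distr_fun mu z < t%:E.
  apply: contrapT => /forallNP H; suff : t%:E <= 0 by rewrite lee_fin leNgt t0.
  apply: (cvge_to_ge (cvg_cdfNy0 (idR : {RV mu >-> R}))); apply: nearW => v.
  by rewrite leNgt; apply/negP/H.
have [w wt] : exists w : R, t%:E < distr_fun mu w.
  apply: contrapT => /forallNP H; suff : 1 <= t%:E by rewrite lee_fin leNgt t1.
  apply: (cvge_to_le (cvg_cdfy1 (idR : {RV mu >-> R}))); apply: nearW => v.
  by rewrite leNgt; apply/negP/H.
rewrite fin_numE -ltNye -ltey; apply/andP; split.
  by rewrite (lt_le_trans (ltNyr z))// le_inv_distr_fun// ltW.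
rewrite (@le_lt_trans _ _ w%:E) ?ltry//; apply: ge_ereal_sup => _ [v vt <-].
rewrite lee_fin leNgt; apply/negP => /ltW /le_distr_fun /(lt_le_trans wt).
by rewrite ltNge vt.
Qed.

Definition quantile (t : R) : R := fine (inv_distr_fun mu t).

Lemma quantileK (t : R) : (0 < t < 1)%R ->
  (quantile t)%:E = inv_distr_fun mu t.
Proof. by move=> t01; rewrite fineK// inv_distr_fun_fin_num. Qed.

Lemma quantile_ndecr (s t : R) : (0 < s)%R -> (s <= t)%R -> (t < 1)%R ->
  (quantile s <= quantile t)%R.
Proof.
move=> s0 st t1; rewrite -lee_fin !quantileK ?inv_distr_fun_ndecr//.
  by rewrite (lt_le_trans s0 st).
by rewrite s0 (le_lt_trans st t1).
Qed.

(** The next three lemmas are the part of the Galois connection between the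
    distribution function and its inverse that holds whatever the jumps of
    either function. *)
Lemma le_quantile (z t : R) : (0 < t < 1)%R ->
  distr_fun mu z <= t%:E -> (z <= quantile t)%R.
Proof. by move=> t01 /le_inv_distr_fun; rewrite -quantileK. Qed.

Lemma distr_fun_lt_quantile (z t : R) : (0 < t < 1)%R ->
  (z < quantile t)%R -> distr_fun mu z <= t%:E.
Proof.
by move=> t01 zt; apply: distr_fun_le_of_lt_inv; rewrite -quantileK.
Qed.

Lemma quantile_le (z t : R) : (0 < t < 1)%R ->
  t%:E < distr_fun mu z -> (quantile t <= z)%R.
Proof.
move=> t01; rewrite leNgt => tz; apply/negP => /distr_fun_lt_quantile.
by move=> /(_ t01); rewrite leNgt tz.
Qed.

End quantile.

(** * Uniform point measures *)

Section empirical.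
Context {R : realType}.
Local Open Scope ereal_scope.

Lemma distr_fun_unif_dirac n (x : n.+1.-tuple R) (t : R) :
  distr_fun (unif_dirac x) t =
  ((count (fun z => (z <= t)%R) x)%:R / n.+1%:R)%:E.
Proof.
rewrite /distr_fun [LHS](unif_diracE x) mulrC EFinM; congr (_ * _).
rewrite -sum1_count big_tuple natr_sum -sumEFin [RHS]big_mkcond /=.
apply: eq_bigr => z _; rewrite diracE.
have -> : (tnth x z \in `]-oo, t]%classic) = (tnth x z <= t)%R.
  by apply/idP/idP; rewrite inE/= in_itv.
by case: ifP.
Qed.

Lemma distr_fun_unif_dirac_ge n (x : n.+1.-tuple R) j :
  sorted <=%R x -> (j < n.+1)%N ->
  (j.+1%:R / n.+1%:R)%:E <= distr_fun (unif_dirac x) (nth 0%R x j).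
Proof.
move=> sx jn; rewrite distr_fun_unif_dirac lee_fin ler_pM2r ?invr_gt0//.
rewrite ler_nat leqNgt ltnS; apply/negP => cj.
suff : (nth 0 x j < nth 0 x j)%R by rewrite ltxx.
by apply: nth_count_gt => //; rewrite size_tuple jn andbT.
Qed.

Lemma distr_fun_unif_dirac_le n (x : n.+1.-tuple R) j (t : R) :
  sorted <=%R x -> (t < nth 0 x j)%R ->
  distr_fun (unif_dirac x) t <= (j%:R / n.+1%:R)%:E.
Proof.
move=> sx tj; rewrite distr_fun_unif_dirac lee_fin ler_pM2r ?invr_gt0//.
rewrite ler_nat leqNgt; apply/negP => /(nth_count_le 0%R sx).
by rewrite leNgt tj.
Qed.

End empirical.

(** * The set defining the Levy distance *)

Section levy_admissible.
Context {R : realType} (eps : R) (mu nu : borel_probability R).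

Definition levy_admissible (y : R) := (0 < y)%R /\ forall x : R,
    (distr_fun_left mu (x - y / eps)%R - y%:E <= distr_fun nu x /\
    distr_fun nu x <= distr_fun mu (x + y / eps)%R + y%:E)%E.

Lemma levy_admissible_has_inf : has_inf [set y : R | levy_admissible y].
Proof.
split; last by exists 0 => y [/ltW].
exists 1; split => // x; split.
  rewrite leeBlDr//; apply: (@le_trans _ _ 1%E); first exact: probability_le1.
  by rewrite leeDr.
apply: (@le_trans _ _ 1%E); first exact: probability_le1.
by rewrite leeDr.
Qed.

Lemma levy_ge0 : 0 <= levy eps mu nu.
Proof.
by apply: lb_le_inf => [|y [/ltW]]//; case: levy_admissible_has_inf.
Qed.

Lemma levy_le y : levy_admissible y -> levy eps mu nu <= y.
Proof. by move=> ?; apply: ge_inf => //; case: levy_admissible_has_inf. Qed.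

Lemma levy_lt c : levy eps mu nu < c -> exists2 y, levy_admissible y & y < c.
Proof. by apply: inf_lt; case: levy_admissible_has_inf. Qed.

End levy_admissible.

(** * Levy distance to a uniform point measure in terms of quantiles *)

Section best_approximation_bounds.
Context {R : realType} (mu : borel_probability R) (eps : R).
Hypothesis eps_gt0 : 0 < eps.

Lemma cell_point_in01 n j (r : R) : (j < n.+1)%N -> 0 < r < 1 ->
  0 < (j%:R + r) / n.+1%:R < 1.
Proof.
move=> jn /andP[r0 r1]; rewrite divr_gt0// ?ltr_wpDl//=.
rewrite ltr_pdivrMr// mul1r; apply: (@lt_le_trans _ _ (j.+1%:R)).
  by rewrite -natr1 ltrD2l.
by rewrite ler_nat.
Qed.

(** For an admissible radius [y], the [j]-th atom plus [y / eps] is above the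
    quantile at the right end of the core of the [j]-th cell, because the mass at
    or below the atom is at least [j.+1 / n.+1]; and the atom minus [y / eps] is
    below the quantile at the left end, because the mass strictly below the atom
    is at most [j / n.+1].  The strict inequality between the radius [y] and
    [c / n.+1] absorbs the possible discontinuities. *)
Lemma levy_quantile_gap n (x : n.+1.-tuple R) (c : R) j :
  sorted <=%R x -> 0 < c < 2^-1 -> levy eps mu (unif_dirac x) < c / n.+1%:R ->
  (j < n.+1)%N ->
  quantile mu ((j%:R + (1 - c)) / n.+1%:R) - quantile mu ((j%:R + c) / n.+1%:R)
    <= 2 * c / (eps * n.+1%:R).
Proof.
move=> sx /andP[c0 c1] /levy_lt[y [y0 adm] yc] jn.
have ye : y / eps < c / (eps * n.+1%:R).
  by rewrite invfM [X in _ < c * X]mulrC mulrA ltr_pM2r ?invr_gt0.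
have upper : quantile mu ((j%:R + (1 - c)) / n.+1%:R) <= nth 0 x j + y / eps.
  apply: quantile_le; first by apply: cell_point_in01 => //; lra.
  have [_] := adm (nth 0 x j).
  move=> /(le_trans (distr_fun_unif_dirac_ge sx jn)).
  rewrite -leeBlDr//; apply: lt_le_trans.
  rewrite -EFinB lte_fin addrA natr1 mulrBl ltrD2l ltrN2.
  exact: yc.
(* The mass strictly below the atom is reached by testing at points at
   distance [e / 2] on its left. *)
have lower : nth 0 x j - y / eps <= quantile mu ((j%:R + c) / n.+1%:R).
  apply/ler_addgt0Pr => e e0.
  rewrite -lerBlDr; apply: le_quantile; first by apply: cell_point_in01 => //; lra.
  have [] := adm (nth 0 x j - e / 2).
  rewrite leeBlDr// => le_left _.
  have xe : nth 0 x j - y / eps - e < nth 0 x j - e / 2 - y / eps by lra.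
  apply: (le_trans (distr_fun_le_left mu xe)); apply: (le_trans le_left).
  have xe2 : nth 0 x j - e / 2 < nth 0 x j by lra.
  apply: (le_trans (leeD2r _ (distr_fun_unif_dirac_le sx xe2))).
  by rewrite -EFinD lee_fin mulrDl lerD2l ltW.
have -> : 2 * c / (eps * n.+1%:R) = c / (eps * n.+1%:R) *+ 2 by ring.
rewrite mulr2n; move: upper lower ye.
by move: (quantile _ _) (quantile _ _) (y / _) (c / _) => *; lra.
Qed.

(** The middle of a cell halves the core for every radius, so that under a
    uniform bound on the increments of the quantile function this single choice
    of atoms meets both constraints for all radii at once. *)
Definition mid_quantiles n : n.+1.-tuple R :=
  [tuple quantile mu ((j%:R + 2^-1) / n.+1%:R) | j < n.+1].

Lemma nth_mid_quantiles n j : (j < n.+1)%N ->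
  nth 0 (mid_quantiles n) j = quantile mu ((j%:R + 2^-1) / n.+1%:R).
Proof.
by move=> jn; rewrite -[j]/(nat_of_ord (Ordinal jn)) -tnth_nth tnth_mktuple.
Qed.

Let half01 : 0 < (2^-1 : R) < 1. Proof. lra. Qed.

Lemma sorted_mid_quantiles n : sorted <=%R (mid_quantiles n).
Proof.
apply/(sortedP 0) => j; rewrite size_tuple => jn.
rewrite !nth_mid_quantiles// 1?ltnW//; apply: quantile_ndecr.
- by case/andP: (cell_point_in01 (ltnW jn) half01).
- by rewrite ler_pM2r ?invr_gt0// lerD2r ler_nat.
- by case/andP: (cell_point_in01 jn half01).
Qed.

(** With [k] atoms at or below [t], the upper inequality at [t] follows from
    [x_(k-1) <= t] and the lower one from [t < x_k].  Each compares such an atom,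
    the quantile of a cell midpoint, with the quantile at an end of the core of
    its cell; when [y] exceeds half a cell that end lies on the far side of the
    midpoint, and monotonicity suffices. *)
Lemma levy_mid_quantiles_le n (y : R) : 0 < y ->
  (forall a b, 0 < a -> a <= b -> b < 1 -> b - a <= (2 * n.+1%:R)^-1 - y ->
     quantile mu b - quantile mu a < y / eps) ->
  levy eps mu (unif_dirac (mid_quantiles n)) <= y.
Proof.
move=> y0 modulus; apply: levy_le; split => // t.
set x := mid_quantiles n.
have sx : sorted <=%R x by exact: sorted_mid_quantiles.
have mid01 j (jn : (j < n.+1)%N) := cell_point_in01 jn half01.
have ye0 : 0 < y / eps by rewrite divr_gt0.
pose k := count (fun z => z <= t) x.
have kn : (k <= n.+1)%N by rewrite -[n.+1](size_tuple x) count_size.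
rewrite distr_fun_unif_dirac -/k; split.
- rewrite leeBlDr// -EFinD.
  have [s1|s1] := leP 1 (k%:R / n.+1%:R + y).
    by rewrite (le_trans (probability_le1 _ _))// lee_fin.
  have {}kn : (k < n.+1)%N.
    rewrite ltn_neqAle kn andbT; apply/negP => /eqP kE; move: s1.
    by rewrite kE divff// gtrDl ltNge ltW.
  set s := _ + y.
  have s01 : 0 < s < 1 by rewrite s1 ltr_wpDl.
  have tx : t < nth 0 x k.
    by apply: nth_count_gt => //; rewrite leqnn size_tuple.
  rewrite nth_mid_quantiles// in tx.
  apply: (le_trans (distr_fun_left_le mu (lexx _))).
  apply: distr_fun_lt_quantile => //.
  have [sm|ms] := leP s ((k%:R + 2^-1) / n.+1%:R).
    have gapE : (k%:R + 2^-1) / n.+1%:R - s = (2 * n.+1%:R)^-1 - y.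
      by rewrite /s invfM mulrDl; ring.
    have := modulus _ _ (andP s01).1 sm (andP (mid01 _ kn)).2.
    rewrite gapE => /(_ (lexx _)); lra.
  have := quantile_ndecr mu (andP (mid01 _ kn)).1 (ltW ms) s1; lra.
- case: (posnP k) => [->|k0].
    by rewrite mul0r -[leLHS](addr0 (0%E : \bar R)) leeD// lee_fin ltW.
  rewrite -leeBlDr// -EFinB.
  have [s0|s0] := leP (k%:R / n.+1%:R - y) 0.
    by apply: (@le_trans _ _ 0%E); rewrite ?lee_fin.
  set s := _ - y.
  have s1 : s < 1.
    rewrite /s ltrBlDr; apply: (@le_lt_trans _ _ 1); last by rewrite ltrDl.
    by rewrite ler_pdivrMr// mul1r ler_nat.
  have s01 : 0 < s < 1 by rewrite s0.
  have kn1 : (k.-1 < n.+1)%N by rewrite prednK.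
  have tx : nth 0 x k.-1 <= t.
    by apply: nth_count_le => //; rewrite -/k prednK.
  rewrite nth_mid_quantiles// in tx.
  rewrite leNgt; apply/negP => /ltW /(le_quantile s01).
  have kE : k%:R = k.-1%:R + 1 :> R by rewrite natr1 prednK.
  have [ms|sm] := leP ((k.-1%:R + 2^-1) / n.+1%:R) s.
    have gapE : s - (k.-1%:R + 2^-1) / n.+1%:R = (2 * n.+1%:R)^-1 - y.
      by rewrite /s kE invfM !mulrDl; field.
    have := modulus _ _ (andP (mid01 _ kn1)).1 ms s1.
    rewrite gapE => /(_ (lexx _)); lra.
  have := quantile_ndecr mu s0 (ltW sm) (andP (mid01 _ kn1)).2; lra.
Qed.

End best_approximation_bounds.

(** * Lebesgue differentiation along cell cores *)

Section cell_cores.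
Context {R : realType}.
Variables (c : R) (phi : nat -> nat).
Hypotheses (c01 : 0 < c < 2^-1) (phi_ge : forall m, (m <= phi m)%N).

Local Notation leb := (@lebesgue_measure R).
Local Notation cell t n := (Num.floor (t * n.+1%:R))%:~R.

(** The index of the cell is a [floor] in [int], so that the family is defined,
    and nicely shrinking, at every real [t]. *)
Definition cell_core n (t : R) : set R :=
  `](cell t n + c) / n.+1%:R, (cell t n + (1 - c)) / n.+1%:R]%classic.

Let core_width n (t : R) :
  (cell t n + (1 - c)) / n.+1%:R = (cell t n + c) / n.+1%:R + (1 - 2 * c) / n.+1%:R.
Proof. by rewrite -mulrDl; congr (_ / _); ring. Qed.

Let one_sub_2c_gt0 : 0 < 1 - 2 * c.
Proof. by case/andP: c01 => *; lra. Qed.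

Let core_width_gt0 n : 0 < (1 - 2 * c) / n.+1%:R :> R.
Proof. exact: divr_gt0. Qed.

Lemma lebesgue_measure_cell_core n (t : R) :
  leb (cell_core n t) = ((1 - 2 * c) / n.+1%:R)%:E.
Proof.
rewrite lebesgue_measure_itv/= lte_fin core_width ltrDl core_width_gt0.
by rewrite -EFinD addrAC subrr add0r.
Qed.

Let ball_radius_gt0 n : 0 < 2 / n.+1%:R :> R.
Proof. exact: divr_gt0. Qed.

(** Although the core may miss [t], it lies in the same cell of length
    [1 / (phi m).+1] as [t], and fills a fixed fraction of it. *)
Lemma nicely_shrinking_cell_core (t : R) :
  nicely_shrinking t (fun m => cell_core (phi m) t).
Proof.
have /andP[c0 c1] := c01.
split=> [m|]; first exact: measurable_itv.
(* The ball of radius 2 / N has measure 4 / N, the core (1 - 2 c) / N. *)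
exists (4 / (1 - 2 * c), fun m => PosNum (ball_radius_gt0 (phi m))); split => /=.
- exact: divr_gt0.
- apply: (@squeeze_cvgr _ _ _ _ (cst 0) (fun m => 2 * harmonic m)).
  + near=> m; rewrite ltW//= ler_pM2l// lef_pV2 ?posrE//.
    by rewrite ler_nat ltnS.
  + exact: cvg_cst.
  + rewrite -[X in _ --> X](mulr0 (2 : R)).
    by apply: cvgM; [exact: cvg_cst|exact: cvg_harmonic].
- move=> m z; rewrite /cell_core/= in_itv/= /ball/= ltr_distlC.
  have N0 : 0 < (phi m).+1%:R :> R by [].
  rewrite ltr_pdivrMr// ler_pdivlMr// => /andP[zl zr].
  rewrite -(ltr_pM2r N0) -[X in _ && X](ltr_pM2r N0) mulrBl [(t + _) * _]mulrDl.
  rewrite divfK ?gt_eqF//.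
  move: (floor_le (t * (phi m).+1%:R)) (floorD1_gt (t * (phi m).+1%:R)) zl zr.
  rewrite intrD; move: (t * _) (z * _) => u v *; apply/andP; split; lra.
- move=> m; rewrite (lebesgue_measure_ball _ (ltW (ball_radius_gt0 _))).
  rewrite lebesgue_measure_cell_core.
  rewrite -EFinM lee_fin mulrA divfK ?gt_eqF//.
  by rewrite le_eqVlt; apply/orP; left; apply/eqP; ring.
Unshelve. all: by end_near. Qed.

Lemma ae_le_of_cell_core_averages (g : R -> R) (a b K : R) :
  locally_integrable setT g ->
  (forall m t, cell_core (phi m) t `<=` `]a, b[ ->
    (\int[leb]_(s in cell_core (phi m) t) (g s)%:E
      <= (K * ((1 - 2 * c) / (phi m).+1%:R))%:E)%E) ->
  {ae leb, forall t : measurableTypeR R, t \in `]a, b[ -> g t <= K}.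
Proof.
move=> locg avg; have := lebesgue_differentiation locg.
apply: filter_app; first exact: (ae_filter_ringOfSetsType leb).
apply: aeW => /= t gt tab.
rewrite -lee_fin.
have := nice_lebesgue_differentiation nicely_shrinking_cell_core locg gt.
move=> /cvge_to_le; apply.
have [r r0 rab] : exists2 r : R, 0 < r & ball t r `<=` `]a, b[.
  have : nbhs t `]a, b[%classic by apply: near_in_itvoo.
  by move=> /nbhs_ballP[r r0 rab]; exists r.
have [_ [[C rad] /= [C0 rad0 core_ball _]]] := nicely_shrinking_cell_core t.
move/cvgrPdist_lt : rad0 => /(_ r r0); apply: filterS => m.
rewrite sub0r normrN => radm.
rewrite lebesgue_measure_cell_core inver gt_eqF// lee_pdivrMl//.
rewrite -EFinM mulrC; apply: avg.
apply: subset_trans rab; apply: subset_trans (core_ball m) _.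
by apply: le_ball; rewrite (le_trans (ler_norm _))// ltW.
Qed.

End cell_cores.

(** * The density of the inverse measure *)

Section density.
Context {R : realType} (mu : borel_probability R).
Variables (muinv : {sigma_finite_measure set (measurableTypeR R) -> \bar R}).
Hypothesis muinvP : is_inverse_measure mu muinv.
Variable f : measurableTypeR R -> R.
Hypothesis fP : is_lebesgue_density muinv f.
Local Notation leb := (@lebesgue_measure R).

Let mf : measurable_fun setT f. Proof. by case: fP. Qed.
Let f_ge0 t : 0 <= f t. Proof. by case: fP. Qed.

Lemma integral_density_quantile (a b : R) : 0 < a -> a <= b -> b < 1 ->
  (\int[leb]_(t in `]a, b]) (f t)%:E)%E = (quantile mu b - quantile mu a)%:E.
Proof.
move=> a0 ab b1; have [_ _ fE] := fP.
rewrite -fE; last exact: measurable_itv.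
have [_ ->//] := muinvP; rewrite EFinB !quantileK//.
  by rewrite a0 (le_lt_trans ab).
by rewrite (lt_le_trans a0).
Qed.

Lemma quantile_increment_le (L a b : R) :
  {ae leb, forall t : measurableTypeR R, f t <= L} -> 0 <= L ->
  0 < a -> a <= b -> b < 1 ->
  quantile mu b - quantile mu a <= L * (b - a).
Proof.
move=> fL L0 a0 ab b1; rewrite -lee_fin -integral_density_quantile//.
have lebab : leb `]a, b]%classic = (b - a)%:E.
  rewrite lebesgue_measure_itv/= lte_fin.
  move: ab; rewrite le_eqVlt => /predU1P[->|->]; last by rewrite EFinB.
  by rewrite ltxx subrr.
have -> : ((L * (b - a))%:E = \int[leb]_(t in `]a, b]) (cst L%:E) t)%E.
  rewrite integral_cst; last exact: measurable_itv.
  by rewrite EFinM -lebab.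
apply: ae_ge0_le_integral => //.
- by move=> t _; rewrite lee_fin.
- by apply/measurable_EFinP; exact: measurable_funTS.
- by move: fL; apply: filterS => t ft _; rewrite lee_fin.
Qed.

Lemma density_ae0 :
  {ae leb, forall t : measurableTypeR R, ~ (t \in `]0, 1[) -> f t = 0}.
Proof.
have [_ _ fE] := fP; have [nu0 _] := muinvP.
pose D : set (measurableTypeR R) := ~` `]0%R, 1%R[%classic.
have mD : measurable D by apply: measurableC; exact: measurable_itv.
have intf0 : (\int[leb]_(t in D) `|(f t)%:E| = 0)%E.
  rewrite -[RHS]nu0 (fE _ mD); apply: eq_integral => t _.
  by rewrite gee0_abs// lee_fin.
have mfD : measurable_fun D (EFin \o f).
  by apply/measurable_EFinP; exact: measurable_funTS.
have := (ae_eq_integral_abs _ mD mfD).1 intf0.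
by apply: filterS => t ft0 t01; have [] := ft0 t01.
Qed.

Lemma locally_integrable_density (a b : R) : 0 < a -> a <= b -> b < 1 ->
  locally_integrable setT (f \_ `]a, b]).
Proof.
move=> a0 ab b1; apply: integrable_locally_restrict.
  exact: measurable_itv.
apply/integrableP; split.
  by apply/measurable_EFinP; exact: measurable_funTS.
under eq_integral do rewrite gee0_abs ?lee_fin//.
by rewrite integral_density_quantile// ltry.
Qed.

(** The density is integrable only on compact subintervals of ]0, 1[, so the
    differentiation theorem is applied to its restrictions to an exhausting
    sequence of such intervals. *)
Lemma density_le_of_quantile_gaps (c K : R) (phi : nat -> nat) :
  0 < c < 2^-1 -> (forall m, (m <= phi m)%N) ->
  (forall m j, (j < (phi m).+1)%N ->
    quantile mu ((j%:R + (1 - c)) / (phi m).+1%:R) -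
    quantile mu ((j%:R + c) / (phi m).+1%:R) <=
      K * ((1 - 2 * c) / (phi m).+1%:R)) ->
  {ae leb, forall t : measurableTypeR R, t \in `]0, 1[ -> f t <= K}.
Proof.
move=> c01 phi_ge gap; have /andP[c0 c1] := c01.
pose a k : R := k.+2%:R^-1; pose b k : R := 1 - a k.
have a0 k : 0 < a k by rewrite invr_gt0.
have ab k : a k <= b k.
  have : a k <= 2^-1 by rewrite lef_pV2 ?posrE// ler_nat.
  by rewrite /b => *; lra.
have b1 k : b k < 1 by rewrite /b; have := a0 k; lra.
suff on_itv k : {ae leb, forall t : measurableTypeR R,
    t \in `]a k, b k[ -> (f \_ `]a k, b k]) t <= K}.
  have := ae_foralln on_itv.
  apply: filterS => t ft; rewrite in_itv/= => /andP[t0 t1].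
  have [k [akt tbk]] : exists k, a k < t /\ t < b k.
    have [k kt] : exists k, k.+1%:R^-1 < Num.min t (1 - t).
      have tt : 0 < Num.min t (1 - t) by rewrite lt_min t0 subr_gt0.
      exists (Num.truncn (Num.min t (1 - t))^-1).
      by rewrite invf_plt ?posrE// truncnS_gt.
    have akk : a k < k.+1%:R^-1 by rewrite ltf_pV2 ?posrE// ltr_nat.
    exists k; move: kt; rewrite lt_min => /andP[kt kt1].
    by split; [exact: lt_trans kt|rewrite ltrBrDr -ltrBrDl; exact: lt_trans kt1].
  have := ft k; rewrite in_itv/= akt tbk => /(_ isT).
  by rewrite patchE mem_set//= in_itv/= akt ltW.
apply: (ae_le_of_cell_core_averages c01 phi_ge).
  exact: locally_integrable_density.
move=> m t coreab.
have subab : cell_core c (phi m) t `<=` `]a k, b k]%classic.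
  by move=> s /coreab/=; rewrite !in_itv/= => /andP[-> /ltW].
rewrite (eq_integral (fun s => (f s)%:E)); last first.
  by move=> s /[!inE] /subab sab; rewrite patchE mem_set.
set N := (phi m).+1%:R.
set fl := Num.floor (t * N).
have N0 : 0 < N by [].
have : (fl%:~R + (1 - c)) / N \in `]a k, b k[.
  apply: coreab; rewrite /cell_core/= in_itv/= lexx andbT ltr_pM2r ?invr_gt0//.
  by rewrite ltrD2l; lra.
rewrite in_itv/= => /andP[/(lt_trans (a0 k)) r0 /lt_trans/(_ (b1 k)) r1].
(* A core meeting ]0, 1[ belongs to one of the cells [0], ..., [phi m]. *)
have fl0 : 0 <= fl.
  move: r0; rewrite pmulr_lgt0 ?invr_gt0// => r0.
  rewrite -ltzD1 -(ltr_int R) intrD; lra.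
have flN : fl < (phi m).+1.
  move: r1; rewrite ltr_pdivrMr// mul1r => r1.
  by rewrite -(ltr_int R) /=; move: r1; rewrite /N; lra.
rewrite /cell_core -/N -/fl; move: fl0 flN r0 r1; case: fl => // j _ jN r0 r1.
have q0 : 0 < (j%:R + c) / N by rewrite divr_gt0// ltr_wpDl.
rewrite integral_density_quantile//; first by rewrite lee_fin; exact: gap.
by rewrite ler_pM2r ?invr_gt0// lerD2l; lra.
Qed.

End density.

(** * The function Omega and the essential supremum *)

(** [Omega x <= c] reads [x <= 2 c + 2 c x]; this form of the inequality, free
    of divisions, also covers [c >= 1/2], where it always holds. *)
Lemma Omega_le (R : realType) (x c : R) : 0 <= x ->
  (Omega x <= c) = (x * (1 - 2 * c) <= 2 * c).
Proof.
move=> x0; rewrite /Omega ger0_norm// ler_pdivrMr; last by lra.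
by apply/idP/idP => ?; lra.
Qed.

Lemma Omega_ge0 (R : realType) (x : R) : 0 <= x -> 0 <= Omega x.
Proof. by move=> x0; rewrite divr_ge0// addr_ge0. Qed.

Lemma Omega_lt_half (R : realType) (x : R) : 0 <= x -> Omega x < 2^-1.
Proof.
by move=> x0; rewrite /Omega ger0_norm// ltr_pdivrMr; lra.
Qed.

Lemma Linfty_leP d (T : measurableType d) (R : realType)
    (nu : {measure set T -> \bar R}) (g : T -> \bar R) (c : \bar R) :
  (0 < nu setT)%E ->
  ('N[nu]_+oo[g] <= c)%E <-> {ae nu, forall t, (`|g t| <= c)%E}.
Proof.
by move=> nuT; rewrite unlock nuT; split=> [/ess_supP|?]; last apply/ess_supP.
Qed.

(** * Bounds for best approximations *)

Section asymptotics.
Context {R : realType} (mu : borel_probability R) (eps : R).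
Hypothesis eps_gt0 : 0 < eps.
Variable muinv : {sigma_finite_measure set (measurableTypeR R) -> \bar R}.
Hypothesis muinvP : is_inverse_measure mu muinv.
Variable f : measurableTypeR R -> R.
Hypothesis fP : is_lebesgue_density muinv f.
Variable x : forall n : nat, n.+1.-tuple R.
Hypothesis xP : forall n : nat, is_best_unif_approx eps mu (x n).
Local Notation leb := (@lebesgue_measure R).

Let f_ge0 t : 0 <= f t. Proof. by case: fP. Qed.

Let epsf_ge0 t : 0 <= eps * f t.
Proof. by rewrite mulr_ge0// ltW. Qed.

Lemma levy_best_le n (c : R) : 0 <= c ->
  (forall y a b, c / n.+1%:R < y -> 0 < a -> a <= b -> b < 1 ->
    b - a <= (2 * n.+1%:R)^-1 - y -> quantile mu b - quantile mu a < y / eps) ->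
  n.+1%:R * levy eps mu (unif_dirac (x n)) <= c.
Proof.
move=> c0 modulus; rewrite mulrC -ler_pdivlMr//.
have [_ xbest] := xP n.
apply: (le_trans (xbest _ (sorted_mid_quantiles mu n))).
apply/ler_addgt0Pr => e e0; apply: levy_mid_quantiles_le => //.
  by rewrite ltr_wpDl// divr_ge0.
by move=> a b; apply: modulus; rewrite ltrDl.
Qed.

(** No two points [a <= b] are at distance at most [1 / (2 N) - y] when [y] is
    larger than half a cell. *)
Lemma levy_best_le_half n : n.+1%:R * levy eps mu (unif_dirac (x n)) <= 2^-1.
Proof.
apply: levy_best_le => [|y a b yc a0 ab b1]; first by rewrite invr_ge0.
rewrite invfM => ba; exfalso; move: ab yc ba.
by move: (_ / _) => u; lra.
Qed.

(** [Omega (eps * f) <= c] bounds [f] by [L = 2 c / (eps (1 - 2 c))], hence the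
    increment of the quantile function over [1 / (2 N) - c / N] by
    [c / (N eps)]: the value of [c] for which both sides agree. *)
Lemma levy_best_le_of_density n (c : R) : 0 <= c -> c < 2^-1 ->
  {ae leb, forall t : measurableTypeR R, Omega (eps * f t) <= c} ->
  n.+1%:R * levy eps mu (unif_dirac (x n)) <= c.
Proof.
move=> c0 c1 Oc; apply: levy_best_le => // y a b yc a0 ab b1 ba.
have w0 : 0 < 1 - 2 * c by lra.
pose L := 2 * c / (eps * (1 - 2 * c)).
have L0 : 0 <= L by rewrite divr_ge0 ?mulr_ge0// ltW.
have fL : {ae leb, forall t : measurableTypeR R, f t <= L}.
  move: Oc; apply: filterS => t; rewrite Omega_le//.
  by rewrite ler_pdivlMr ?mulr_gt0// [f t * _]mulrA [f t * _]mulrC.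
apply: (le_lt_trans (quantile_increment_le muinvP fP fL L0 a0 ab b1)).
apply: (@le_lt_trans _ _ (L * ((2 * n.+1%:R)^-1 - c / n.+1%:R))).
  by rewrite ler_wpM2l// (le_trans ba)// lerD2l lerN2 ltW.
suff -> : L * ((2 * n.+1%:R)^-1 - c / n.+1%:R) = c / n.+1%:R / eps.
  by rewrite ltr_pM2r ?invr_gt0.
rewrite /L; field.
by rewrite !gt_eqF//=; lra.
Qed.

(** If the conclusion fails, the approximations are too good along some
    [phi m >= m]; the quantile gaps along [phi] then bound the density. *)
Lemma near_levy_best_ge (c : R) : 0 < c -> c < 2^-1 ->
  ~ {ae leb, forall t : measurableTypeR R, Omega (eps * f t) <= c} ->
  \forall n \near \oo, c <= n.+1%:R * levy eps mu (unif_dirac (x n)).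
Proof.
move=> c0 c1 notOc; apply: contrapT => notnear; apply: notOc.
have w0 : 0 < 1 - 2 * c by lra.
have /choice[phi phiP] : forall m, exists n, (m <= n)%N /\
    n.+1%:R * levy eps mu (unif_dirac (x n)) < c.
  move=> m; apply: contrapT => /forallNP H; apply: notnear.
  exists m => // n /= mn; rewrite leNgt; apply/negP => nc.
  by apply: (H n).
have phi_ge m : (m <= phi m)%N by case: (phiP m).
pose K := 2 * c / (eps * (1 - 2 * c)).
have fK : {ae leb, forall t : measurableTypeR R, t \in `]0, 1[ -> f t <= K}.
  apply: (density_le_of_quantile_gaps muinvP fP _ phi_ge (c := c)).
    by rewrite c0.
  move=> m j jm; have [_ levyc] := phiP m; have [sx _] := xP (phi m).
  have -> : K * ((1 - 2 * c) / (phi m).+1%:R) = 2 * c / (eps * (phi m).+1%:R).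
    by rewrite /K; field; rewrite !gt_eqF//=; lra.
  apply: (levy_quantile_gap eps_gt0 sx) => //; first by rewrite c0.
  by rewrite ltr_pdivlMr// mulrC.
move: (density_ae0 muinvP fP) fK; apply: filterS2 => t f0 fK.
rewrite Omega_le//.
have [t01|/f0 ->] := pselect (t \in `]0, 1[).
  have := fK t01.
  by rewrite ler_pdivlMr ?mulr_gt0// [f t * _]mulrA [f t * _]mulrC.
by rewrite mulr0 mul0r mulr_ge0// ltW.
Qed.

Lemma Linfty_Omega_leP (c : R) :
  ('N[leb]_+oo [(fun t => (Omega (eps * f t))%:E)] <= c%:E)%E <->
  {ae leb, forall t : measurableTypeR R, Omega (eps * f t) <= c}.
Proof.
have lebT : (0 < leb setT)%E.
  by rewrite -set_itvNyy lebesgue_measure_itv/= addye.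
have OE t : (`|(Omega (eps * f t))%:E| = (Omega (eps * f t))%:E)%E.
  by rewrite gee0_abs// lee_fin Omega_ge0.
split=> [/(Linfty_leP _ _ lebT)|Oc]; last apply/(Linfty_leP _ _ lebT).
- by apply: filterS => t; rewrite OE lee_fin.
- by move: Oc; apply: filterS => t; rewrite OE lee_fin.
Qed.

End asymptotics.

Unset Implicit Arguments.

Theorem theorem3p3 (R : realType) (mu : borel_probability R) (eps : R)
    (eps_gt0 : 0 < eps)
    (muinv : {sigma_finite_measure set (measurableTypeR R) -> \bar R})
    (muinvP : is_inverse_measure mu muinv)
    (muinv_ac : muinv `<< @lebesgue_measure R)
    (f : measurableTypeR R -> R) (fP : is_lebesgue_density muinv f)
    (x : forall n : nat, n.+1.-tuple R)
    (xP : forall n : nat, is_best_unif_approx eps mu (x n)) :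
  (n.+1%:R * levy eps mu (unif_dirac (x n)))%:E @[n --> \oo] -->
    ('N[@lebesgue_measure R]_+oo [(fun t => (Omega (eps * f t))%:E)])%E.
Proof.
have [_ f_ge0 _] := fP.
have epsf_ge0 t : 0 <= eps * f t by rewrite mulr_ge0// ltW.
have normP := Linfty_Omega_leP eps_gt0 fP.
set M := ('N[_]_+oo[_])%E in normP *.
have M0 : (0 <= M)%E by exact: Lnorm_ge0.
have Mhalf : (M <= (2^-1)%:E)%E.
  by apply/normP; apply: aeW => t; rewrite ltW// Omega_lt_half.
have Mfin : M \is a fin_num.
  by rewrite ge0_fin_numE// (le_lt_trans Mhalf) ?ltry.
rewrite -(fineK Mfin) in M0 Mhalf normP *.
move: (fine M) M0 Mhalf normP => m; rewrite !lee_fin => m0 m_half normP.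
apply: cvg_EFin; first by exact: nearW.
apply/cvgrPdist_le => e e0.
have upper n : n.+1%:R * levy eps mu (unif_dirac (x n)) <= m.
  (* An essentially unbounded density gives [m = 1/2]. *)
  move: m_half; rewrite le_eqVlt => /predU1P[->|m1].
    exact: levy_best_le_half.
  by apply: (levy_best_le_of_density eps_gt0 muinvP fP xP) => //; exact/normP.
have lower : \forall n \near \oo,
    m - e <= n.+1%:R * levy eps mu (unif_dirac (x n)).
  have [me|me] := lerP (m - e) 0.
    by apply: nearW => n; rewrite (le_trans me)// mulr_ge0// levy_ge0.
  apply: (near_levy_best_ge eps_gt0 muinvP fP xP) => //; first by lra.
  by move/normP; rewrite lee_fin; lra.
move: lower; apply: filterS => n mn.
by rewrite /= ger0_norm ?subr_ge0// lerBlDl -lerBlDr.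
Qed.
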